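(* Let $f:\mathbb{R}\to\mathbb{R}$ be a given function. A particular solution of the linear difference equation $$y(t+h)-\lambda y(t)=f(t),\qquad \lambda\neq 0,\quad h>0,$$ is given by $$y_p(t)=\sum_{s=1}^{\lfloor t\rfloor_h}\lambda^{s-1}f(t-hs).$$
   Context: $\lambda$ and $h$ are constants. For $h>0$ the floor function modulo $h$ is the function $\lfloor\cdot\rfloor_h:\mathbb{R}\to\mathbb{Z}$ defined by $\lfloor t\rfloor_h=n$, where $t=nh+r$ with $n\in\mathbb{Z}$ and $0\le r<h$; equivalently $\lfloor t\rfloor_h=\lfloor t/h\rfloor$. A sum whose upper limit is smaller than its lower limit equals $0$.
   Formalization: The equation is claimed only for t ≥ 0: for t < 0 both sums are empty, hence 0, so the equation would force f(t) = 0 and fails for example for f = 1, λ = h = 1, t = −1/2. *)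

(* Defs.v *)
From mathcomp Require Import all_boot all_order all_algebra.
From mathcomp Require Import reals.

Set Implicit Arguments.
Unset Strict Implicit.
Unset Printing Implicit Defensive.

Import Order.TTheory GRing.Theory Num.Theory.
Local Open Scope ring_scope.

Definition floor_mod (R : realType) (h t : R) : int := Num.floor (t / h).

Lemma floor_modP (R : realType) (h t : R) (n : int) : 0 < h ->
  floor_mod h t = n <-> exists2 r : R, t = n%:~R * h + r & 0 <= r < h.
Proof.
move=> h0; rewrite /floor_mod; split=> [<-|[r -> /andP[r0 rh]]].
  have /andP[l u] := floor_itv (t / h).
  exists (t - (Num.floor (t / h))%:~R * h); first by rewrite addrC subrK.
  rewrite subr_ge0 -ler_pdivlMr // l /= ltrBlDl -[X in _ + X]mul1r -mulrDl.
  by rewrite -ltr_pdivrMr // -[1](mulr1z 1) -intrD.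
apply: floor_def; rewrite ler_pdivlMr // ltr_pdivrMr //.
by rewrite lerDl r0 intrD mulrDl mul1r ltrD2l rh.
Qed.

(* Sum over all integers s with a <= s <= b; it is 0 when b < a. *)
Definition sum_int (V : nmodType) (a b : int) (F : int -> V) : V :=
  if a <= b then \sum_(0 <= k < `|b - a|%N.+1) F (a + k%:Z) else 0.

Definition solves_difference_eq_on (R : realType) (D : interval R)
    (lambda h : R) (f y : R -> R) : Prop :=
  forall t : R, t \in D -> y (t + h) - lambda * y t = f t.

Definition particular_solution (R : realType) (lambda h : R) (f : R -> R)
    (t : R) : R :=
  sum_int 1 (floor_mod h t)
    (fun s : int => lambda ^ (s - 1) * f (t - h * s%:~R)).

(* Both sums are empty when t < 0, so the equation can hold there only at the
   zeros of f; this is why a solution is meant on the half-line t >= 0. *)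
Lemma particular_solution_neg (R : realType) (lambda h : R) (f : R -> R)
    (t : R) : 0 < h -> t < 0 ->
  particular_solution lambda h f (t + h)
    - lambda * particular_solution lambda h f t = 0.
Proof.
move=> h0 t0; rewrite /particular_solution /sum_int /floor_mod.
have small (x : R) : x < h -> (1 <= Num.floor (x / h)) = false.
  by move=> xh; rewrite floor_ge_int mulr1z ler_pdivlMr // mul1r leNgt xh.
by rewrite !small ?mulr0 ?subr0 // ?(lt_trans t0) // gtrDr.
Qed.

(* Main.v *)
Require Import Defs.
From mathcomp Require Import all_boot all_order all_algebra.
From mathcomp Require Import reals.

Set Implicit Arguments.
Unset Strict Implicit.
Unset Printing Implicit Defensive.

Import Order.TTheory GRing.Theory Num.Theory.
Local Open Scope ring_scope.

(** Moving from [t] to [t + h] raises the floor from [n] to [n + 1], and since [n >= 0] when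
    [t >= 0], the sum gains exactly one term. Its first term is [f t]; every later one is [lambda]
    times a term of the sum at [t], so the difference telescopes to [f t]. [floor_modDh] gives the
    shift, [particular_solution_nat] the form of the sum. *)

Lemma sum_int1 (V : nmodType) (n : nat) (F : int -> V) :
  sum_int 1 n F = \sum_(0 <= k < n) F k.+1.
Proof.
(* For [n = 0] the guard [1 <= 0] fails; without it, the absolute value in the length would yield
   two terms. *)
rewrite /sum_int; case: n => [|n]; first by rewrite lez_nat [RHS]big_geq.
have -> : `|n.+1%:Z - 1|%N = n by rewrite -[n.+1]addn1 PoszD addrK absz_nat.
rewrite lez_nat /=.
by apply: eq_bigr => k _; rewrite -PoszD add1n.
Qed.

Lemma floor_modDh (R : realType) (h t : R) : 0 < h ->
  floor_mod h (t + h) = floor_mod h t + 1.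
Proof.
move=> h0; rewrite /floor_mod mulrDl (divff (lt0r_neq0 h0)).
by rewrite floorDrz // floor1.
Qed.

Lemma floor_mod_ge0 (R : realType) (h t : R) : 0 < h -> 0 <= t ->
  0 <= floor_mod h t.
Proof. by move=> h0 t0; rewrite /floor_mod floor_ge0 divr_ge0 // ltW. Qed.

(** Substituting [s = k + 1] turns the integer power into a natural one, so that the first term can
    be split off. *)
Lemma particular_solution_nat (R : realType) (lambda h : R) (f : R -> R)
    (t : R) (n : nat) : floor_mod h t = n ->
  particular_solution lambda h f t =
    \sum_(0 <= k < n) lambda ^+ k * f (t - h * k.+1%:R).
Proof.
move=> tn; rewrite /particular_solution tn sum_int1.
apply: eq_bigr => k _; congr (_ * _).
by rewrite -[k.+1]addn1 PoszD addrK.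
Qed.

Theorem theorem2p16 (R : realType) (lambda h : R) (f : R -> R)
    (hlambda : lambda != 0) (hh : 0 < h) :
  solves_difference_eq_on `[0, +oo[ lambda h f (particular_solution lambda h f).
Proof.
move=> t; rewrite in_itv /= andbT => t0.
have [n tn] : exists n : nat, floor_mod h t = n.
  by exists `|floor_mod h t|%N; rewrite gez0_abs // floor_mod_ge0.
have thn : floor_mod h (t + h) = n.+1.
  by rewrite floor_modDh // tn -PoszD addn1.
rewrite (particular_solution_nat _ _ thn) (particular_solution_nat _ _ tn).
(* The term [k = 0] at [t + h] is [f (t + h - h) = f t]. *)
rewrite big_nat_recl // expr0 mul1r mulr1 addrK mulr_sumr -addrA -sumrB.
rewrite big1 ?addr0 // => k _.
(* The arguments agree: [t + h - h * (k + 2) = t - h * (k + 1)]. *)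
by rewrite exprS -mulrA -[k.+2]add1n natrD mulrDr mulr1 opprD addrA addrK subrr.
Qed.
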